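(* For every integer $k \ge 1$, we have $\pi(\hat{\mathbb{T}}_{2k}^{2k+1}) < 1/2$.
   Context: An $r$-graph is a collection of $r$-element subsets (edges) of a vertex set. The Turán density of an $r$-graph $F$ is $\pi(F)=\lim_{n\to\infty}\mathrm{ex}(n,F)/\binom{n}{r}$, where $\mathrm{ex}(n,F)$ is the maximum number of edges of an $r$-graph on $n$ vertices not containing $F$ as a subgraph. For $k\ge1$, the expanded triangle $\mathbb{T}_{2k}$ is the $2k$-graph $\{S_1\cup S_2, S_2\cup S_3, S_3\cup S_1\}$ where $S_1,S_2,S_3$ are pairwise disjoint $k$-element sets. For $r\ge s$ and an $s$-graph $F$, the $r$-suspension $\hat{F}^{r}$ is $\{C\cup e: e\in F\}$ with $C$ an $(r-s)$-element set disjoint from the vertex set of $F$. Thus $\hat{\mathbb{T}}_{2k}^{2k+1}$ is the $(2k+1)$-graph obtained by adding one new common vertex to each of the three edges of $\mathbb{T}_{2k}$. *)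

(* Defs.v *)
From mathcomp Require Import reals topology normedtype sequences.
From mathcomp Require Import all_boot all_order all_algebra.
From mathcomp Require Import zify.
Import Order.TTheory GRing.Theory Num.Theory.
Import numFieldNormedType.Exports.

Set Implicit Arguments.
Unset Strict Implicit.
Unset Printing Implicit Defensive.

Local Open Scope nat_scope.

(* A hypergraph on the finite vertex type [T] is given by its set of edges. *)
Definition rgraph (r : nat) (T : finType) (E : {set {set T}}) : bool :=
  [forall e in E, #|e| == r].

Definition contains (U T : finType) (F : {set {set U}}) (E : {set {set T}}) :
    bool :=
  [exists f : {ffun U -> T}, injectiveb f && [forall e in F, f @: e \in E]].

Definition ex (r : nat) (U : finType) (F : {set {set U}}) (n : nat) : nat :=
  \max_(E : {set {set 'I_n}} | rgraph r E && ~~ contains F E) #|E|.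

Definition turan_ratio (R : realType) (r : nat) (U : finType)
    (F : {set {set U}}) (n : nat) : R :=
  ((ex r F n)%:R / 'C(n, r)%:R)%R.

(* [limn] is total; the limit does exist, see [is_cvg_turan_ratio]. *)
Definition turan_density (R : realType) (r : nat) (U : finType)
    (F : {set {set U}}) : R :=
  limn (turan_ratio R r F).

Definition triangle_part (k : nat) (i : 'I_3) : {set 'I_3 * 'I_k} :=
  [set x | x.1 == i].

Definition expanded_triangle (k : nat) : {set {set 'I_3 * 'I_k}} :=
  let S1 := triangle_part k (inord 0) in
  let S2 := triangle_part k (inord 1) in
  let S3 := triangle_part k (inord 2) in
  [set S1 :|: S2; S2 :|: S3; S3 :|: S1].

(* The [r - s] new vertices are the elements [inl c]. *)
Definition suspension (s r : nat) (U : finType) (F : {set {set U}}) :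
    {set {set 'I_(r - s) + U}} :=
  [set [set inl c | c : 'I_(r - s)] :|: [set inr x | x in (e : {set U})] | e in F].

Lemma rgraph_expanded_triangle (k : nat) :
  rgraph (2 * k) (expanded_triangle k).
Proof.
have cS i : #|triangle_part k i| = k.
  rewrite (_ : triangle_part k i = [set (i, y) | y : 'I_k]).
    by rewrite card_imset ?card_ord // => a b [].
  apply/setP => -[a b]; rewrite inE /=; apply/eqP/imsetP => [->|[y _ [-> _]]//].
  by exists b.
have dS i j : i != j -> #|triangle_part k i :|: triangle_part k j| = 2 * k.
  move=> ij; rewrite cardsU !cS (_ : _ :&: _ = set0) ?cards0; first lia.
  apply/setP => x; rewrite !inE; apply/negP => /andP[/eqP-> /eqP ji].
  by rewrite ji eqxx in ij.
apply/forall_inP => e; rewrite !inE -orbA => /or3P[] /eqP->; apply/eqP/dS;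
  by apply/eqP => /(congr1 val); rewrite /= !inordK.
Qed.

Lemma rgraph_suspension (s r : nat) (U : finType) (F : {set {set U}}) :
  s <= r -> rgraph s F -> rgraph r (suspension s r F).
Proof.
move=> sr /forall_inP Fs; apply/forall_inP => _ /imsetP[e eF ->].
rewrite cardsU (_ : _ :&: _ = set0); last first.
  by apply/setP => x; rewrite !inE; apply/negP => /andP[/imsetP[? _ ->] /imsetP[]].
rewrite cards0 !card_imset ?card_ord; [|by move=> ? ? []..].
by rewrite (eqP (Fs e eF)); lia.
Qed.

Lemma ex_le_bin (r : nat) (U : finType) (F : {set {set U}}) (n : nat) :
  ex r F n <= 'C(n, r).
Proof.
apply/bigmax_leqP => E /andP[/forall_inP Er _].
rewrite -[n in 'C(n, _)]card_ord -card_draws; apply/subset_leq_card/fintype.subsetP => e eE.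
by rewrite inE Er.
Qed.

Lemma ex_succ (r : nat) (U : finType) (F : {set {set U}}) (n : nat) :
  (n.+1 - r) * ex r F n.+1 <= n.+1 * ex r F n.
Proof.
rewrite [X in _ * X <= _]/ex.
elim/big_ind: _ => [|a b Ha Hb|E /andP[/forall_inP Er EF]].
- by rewrite muln0.
- by rewrite /maxn; case: ifP.
pose link (v : 'I_n.+1) := [set e : {set 'I_n} | lift v @: e \in E].
have link_ex v : #|link v| <= ex r F n.
  apply: (leq_bigmax_cond (link v)); apply/andP; split.
    apply/forall_inP => e; rewrite inE => /Er.
    by rewrite card_imset //; exact: lift_inj.
  apply: contra EF => /existsP[f /andP[/injectiveP f_inj /forall_inP fF]].
  apply/existsP; exists [ffun x => lift v (f x)]; apply/andP; split.
    by apply/injectiveP => x y; rewrite !ffunE => /lift_inj/f_inj.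
  apply/forall_inP => e /fF; rewrite inE -imset_comp.
  suff -> : [ffun x => lift v (f x)] @: e = (lift v \o f) @: e by [].
  by apply: eq_imset => x; rewrite ffunE.
have linkE v : #|link v| = \sum_(e in E) (v \notin e).
  rewrite -big_mkcondr sum1_card /=.
  rewrite -(card_imset (link v) (imset_inj (@lift_inj _ v))).
  apply: eq_card => e; apply/imsetP/andP => [[e' + ->]|[eE ve]].
    rewrite inE => e'E; split=> //; apply/imsetP => -[x _ /eqP].
    by rewrite (negPf (neq_lift _ _)).
  have e_lift : lift v @: (lift v @^-1: e) = e.
    apply/setP => x; apply/imsetP/idP => [[y + ->]|xe]; first by rewrite inE.
    case: (unliftP v x) => [y xy|xv]; last by rewrite -xv xe in ve.
    by exists y; rewrite // inE -xy.
  by exists (lift v @^-1: e); rewrite // inE e_lift.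
have -> : (n.+1 - r) * #|E| = \sum_v #|link v|.
  rewrite (eq_bigr _ (fun v _ => linkE v)) exchange_big /= mulnC -sum_nat_const.
  apply: eq_bigr => e eE; rewrite -big_mkcond sum1_card -(eqP (Er e eE)).
  have -> : #|[pred v | v \notin e]| = #|~: e|.
    by apply: eq_card => v; rewrite !inE.
  by have := cardsC e; rewrite card_ord; lia.
rewrite -[X in _ <= X * _](card_ord n.+1) -sum_nat_const.
exact: leq_sum.
Qed.

Lemma is_cvg_turan_ratio (R : realType) (r : nat) (U : finType)
    (F : {set {set U}}) : cvgn (turan_ratio R r F).
Proof.
apply: (@near_nonincreasing_is_cvgn _ _ 0%R); last first.
  by apply: nearW => n; rewrite /turan_ratio divr_ge0.
exists r => // n /= rn m; elim: m => [|m IHm].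
  by rewrite leqn0 => /eqP->.
rewrite leq_eqVlt => /predU1P[<- //|]; rewrite ltnS => nm.
apply: (le_trans _ (IHm nm)); have rm := leq_trans rn nm.
rewrite /turan_ratio ler_pdivrMr ?ltr0n ?bin_gt0 1?ltnW //.
rewrite mulrAC ler_pdivlMr ?ltr0n ?bin_gt0 // -!natrM ler_nat.
have dm : 0 < m.+1 - r by rewrite subn_gt0 ltnS.
rewrite -(leq_pmul2l dm) mulnA [leqRHS]mulnCA -mul_bin_down /= mulnCA mulnA.
by rewrite leq_mul2r ex_succ orbT.
Qed.

(* Main.v *)
(* The ratio ex(n)/C(n,r) is nonincreasing, so it suffices to find one n at which
   it is below 1/2.  Fix a vertex v and t pairwise disjoint k-sets S_i.  For a
   uniformly random permutation s, join i and j when the image under s of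
   v + S_i + S_j is an edge: this graph is triangle-free, so a Mantel-type count
   shows that if it has t^2/4 - O(t) edges on average, then only a fraction
   O(1/t) of the triples of indices span exactly one edge.
   On the other hand such triples cannot be rare unless there are few edges.
   Let h be the indicator of the edge set modulo 2.  If every configuration
   (v; S1, S2, S3) inside a set A of at least 3k+2 vertices spans an even number
   of edges, then h(v+R) + h(w+R) does not change when a block of R is replaced
   by a disjoint one; summing the parity conditions at v and w gives
   3 (h(v+R) + h(w+R)) = 0, so h is constant on the (2k+1)-subsets of A, and then
   3h = 0 forces h = 0.  Hence every edge gives a configuration with exactly one
   edge in a set of bounded size around it. *)
Require Import Defs.
From mathcomp Require Import reals topology normedtype sequences.
From mathcomp Require Import all_boot all_order all_algebra.
From mathcomp Require Import fingroup perm zify.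
Import Order.TTheory GRing.Theory Num.Theory numFieldNormedType.Exports.

Set Implicit Arguments.
Unset Strict Implicit.
Unset Printing Implicit Defensive.

Local Open Scope nat_scope.

(** * Permutations, subsets and configurations *)

(** Along the enumeration of [T] the two colour sequences agree as multisets, so a permutation of
    positions matches them; it is then transported to [T]. *)
Lemma perm_color (T : finType) (C : eqType) (f g : T -> C) :
  (forall c, #|[set x | f x == c]| = #|[set x | g x == c]|) ->
  exists s : {perm T}, forall x, g (s x) = f x.
Proof.
move=> fg; pose tup (h : T -> C) := [tuple h (tnth (enum_tuple T) i) | i < #|T|].
have tupE (h : T -> C) : tup h = map h (enum T) :> seq C.
  by rewrite /= (map_comp h) map_tnth_enum.
have cnt (h : T -> C) c : count_mem c (map h (enum T)) = #|[set x | h x == c]|.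
  rewrite count_map cardE /enum_mem size_filter count_filter.
  by apply: eq_count => x; rewrite /= inE andbT.
have /tuple_permP[p pE] : perm_eq (tup f) (tup g).
  by rewrite !tupE; apply/allP => c _ /=; rewrite !cnt fg.
have sinj : injective (fun x : T => enum_val (p (enum_rank x))).
  by move=> x y /enum_val_inj/perm_inj/enum_rank_inj.
exists (perm sinj) => x; rewrite permE.
have /(congr1 (fun t => tnth t (enum_rank x))) := val_inj pE.
rewrite !tnth_mktuple => fE; rewrite -[in RHS](enum_rankK x).
rewrite !(enum_val_nth x) -!(tnth_nth x (enum_tuple T)).
by rewrite fE.
Qed.

Lemma subset_of_card (T : finType) (A : {set T}) (k : nat) :
  k <= #|A| -> exists2 B : {set T}, B \subset A & #|B| = k.
Proof.
move=> kA; exists [set x in take k (enum A)].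
  by apply/subsetP => x; rewrite inE => /mem_take; rewrite mem_enum.
rewrite cardsE (card_uniqP (take_uniq k (enum_uniq A))) size_takel //.
by rewrite -cardE.
Qed.

Definition spoke (T : finType) (v : T) (S1 S2 : {set T}) : {set T} :=
  v |: (S1 :|: S2).

(** This is a placement of the vertices of the suspended expanded triangle, up to relabelling inside
    the blocks; its edges go to the three [spoke]s. *)
Definition config (T : finType) (k : nat) (v : T) (S1 S2 S3 : {set T}) : bool :=
  [&& v \notin S1, v \notin S2, v \notin S3,
      #|S1| == k, #|S2| == k, #|S3| == k,
      [disjoint S1 & S2], [disjoint S2 & S3] & [disjoint S1 & S3]].

Lemma config_rot (T : finType) (k : nat) (v : T) (S1 S2 S3 : {set T}) :
  config k v S1 S2 S3 -> config k v S2 S3 S1.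
Proof.
move=> /and5P[? ? ? ? /and5P[? ? d12 ? d13]].
by apply/and5P; split=> //; apply/and5P; split=> //; rewrite disjoint_sym.
Qed.

Lemma spokeC (T : finType) (v : T) (S1 S2 : {set T}) :
  spoke v S1 S2 = spoke v S2 S1.
Proof. by rewrite /spoke (setUC S1). Qed.

(** * Parity: if all configurations in [A] are even, [A] spans no edge *)

Section EvenConfigs.

Variables (T : finType) (k : nat) (A : {set T}) (h : {set T} -> bool).
Hypothesis k_gt0 : 0 < k.
Hypothesis cardA : 3 * k + 2 <= #|A|.
Hypothesis even : forall (v : T) (S1 S2 S3 : {set T}),
  v \in A -> S1 \subset A -> S2 \subset A -> S3 \subset A ->
  config k v S1 S2 S3 ->
  h (spoke v S1 S2) (+) h (spoke v S2 S3) (+) h (spoke v S1 S3) = false.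

Let swap_block v w (S1 S2 S3 : {set T}) :
  v \in A -> w \in A -> S1 \subset A -> S2 \subset A -> S3 \subset A ->
  config k v S1 S2 S3 -> config k w S1 S2 S3 ->
  h (spoke v S1 S2) (+) h (spoke w S1 S2) =
  h (spoke v S1 S3) (+) h (spoke w S1 S3).
Proof.
move=> vA wA S1A S2A S3A cv cw.
(* Recentre at a point u of S1: exchanging u with v, resp. w, leaves v + S1 + S2
   and v + S1 + S3 unchanged, while the third edge u + S2 + S3 is common to both. *)
have [u uS1] : exists u, u \in S1.
  by apply/card_gt0P; move: cv => /and5P[_ _ _ /eqP-> _].
have key x : x \in A -> config k x S1 S2 S3 ->
    h (spoke x S1 S2) (+) h (spoke u S2 S3) (+) h (spoke x S1 S3) = false.
  move=> xA /and5P[x1 x2 x3 /eqP c1 /and5P[/eqP c2 /eqP c3 d12 d23 d13]].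
  have sub1 : S1 :\ u \subset A by rewrite (subset_trans _ S1A) ?subD1set.
  have eqS S : spoke u (x |: S1 :\ u) S = spoke x S1 S.
    apply/setP => y; rewrite !inE; have [->|] := eqVneq y u.
      by rewrite uS1 /= orbT.
    by move=> _ /=; rewrite orbA.
  rewrite -!eqS; apply: even => //.
  - exact: subsetP S1A u uS1.
  - by rewrite subUset sub1 sub1set xA.
  have ux : u != x by apply: contraNneq x1 => <-.
  have dj (S : {set T}) :
      x \notin S -> [disjoint S1 & S] -> [disjoint x |: S1 :\ u & S].
    move=> xS d; rewrite -setI_eq0 setIUl setU_eq0 !setI_eq0 disjoints1 xS.
    by apply: disjointWl d; apply: subD1set.
  rewrite /config !dj // !inE eqxx /= orbF ux c2 c3 d23 !eqxx /= cardsU1 !inE.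
  rewrite (negPf x1) andbF /= add1n.
  have := cardsD1 u S1; rewrite uS1 c1 add1n => <-.
  by rewrite eqxx (disjointFr d12) // (disjointFr d13).
by have := key v vA cv; have := key w wA cw; do 5 case: (h _).
Qed.

(** Let d_ij be the sum modulo 2 of [h] on the spokes over S_i, S_j at [v] and at [w]. Two uses of
    [swap_block] give d_12 = d_13 and d_23 = d_12, while adding the parity conditions at [v] and [w]
    gives d_12 + d_23 + d_13 = 0. Hence d_12 = 0. *)
Let swap_center v w (S1 S2 S3 : {set T}) :
  v \in A -> w \in A -> S1 \subset A -> S2 \subset A -> S3 \subset A ->
  config k v S1 S2 S3 -> config k w S1 S2 S3 ->
  h (spoke v S1 S2) = h (spoke w S1 S2).
Proof.
move=> vA wA S1A S2A S3A cv cw.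
have := swap_block vA wA S1A S2A S3A cv cw.
have := swap_block vA wA S2A S3A S1A (config_rot cv) (config_rot cw).
have := even vA S1A S2A S3A cv; have := even wA S1A S2A S3A cw.
rewrite !(spokeC _ S2 S1).
by do 6 case: (h _).
Qed.

Let split_block (R : {set T}) :
  R \subset A -> #|R| = 2 * k -> exists S1 S2 : {set T},
  [/\ S1 \subset A /\ S2 \subset A, #|S1| = k, #|S2| = k, [disjoint S1 & S2]
    & R = S1 :|: S2].
Proof.
move=> RA cR; have [|S1 S1R c1] := @subset_of_card _ R k; first by lia.
exists S1, (R :\: S1); split=> //.
- by split; [exact: subset_trans RA | exact: subset_trans (subsetDl _ _) RA].
- by rewrite cardsDS // cR c1; lia.
- by rewrite disjoint_sym disjoints_subset setDE subsetIr.
- by rewrite -[LHS](setID R S1) (setIidPr S1R).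
Qed.

Let exchange v w (R : {set T}) :
  v \in A -> w \in A -> R \subset A -> #|R| = 2 * k ->
  v \notin R -> w \notin R -> h (v |: R) = h (w |: R).
Proof.
move=> vA wA RA cR vR wR.
(* The third block must avoid the 2k points of [R] as well as [v] and [w]; this is where [A] needs
   3k+2 points. *)
have [|S3 /subsetDP[S3A d3] c3] := @subset_of_card _ (A :\: (v |: (w |: R))) k.
  have := cardsU1 v (w |: R); have := cardsU1 w R.
  have := subset_leq_card (subsetIr A (v |: (w |: R))).
  by rewrite cardsD; do 2 case: (_ \notin _); lia.
have [S1 [S2 [[S1A S2A] c1 c2 d12 RE]]] := split_block RA cR.
rewrite {}RE {cR RA} in vR wR d3 *.
have cfg x : x \in v |: (w |: (S1 :|: S2)) -> x \notin S1 :|: S2 ->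
    config k x S1 S2 S3.
  move=> xX; rewrite inE negb_or => /andP[x1 x2].
  have dj (S : {set T}) : S \subset S1 :|: S2 -> [disjoint S & S3].
    move=> sub; rewrite disjoint_sym; apply: disjointWr d3.
    by rewrite (subset_trans sub) // setUA subsetUr.
  rewrite /config x1 x2 (disjointFl d3 xX) c1 c2 c3 d12.
  by rewrite !dj ?subsetUl ?subsetUr ?eqxx.
rewrite -!/(spoke _ S1 S2).
by apply: (swap_center (S3 := S3)) => //; apply: cfg; rewrite // !inE eqxx ?orbT.
Qed.

(** Induction on the size of [e :\: f]: each [exchange] replaces a vertex of [e] outside [f] by a
    vertex of [f] outside [e]. *)
Let const (e f : {set T}) : e \subset A -> f \subset A ->
  #|e| = 2 * k + 1 -> #|f| = 2 * k + 1 -> h e = h f.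
Proof.
move En: #|e :\: f| => n; elim: n e En => [|n IH] e En eA fA ce cf.
  move/eqP: En; rewrite cards_eq0 setD_eq0 => ef.
  by congr h; apply/eqP; rewrite eqEcard ef ce cf leqnn.
have /card_gt0P[v] : 0 < #|e :\: f| by rewrite En.
rewrite inE => /andP[vf ve].
have /card_gt0P[w] : 0 < #|f :\: e|.
  by have := cardsID f e; have := cardsID e f; rewrite setIC; lia.
rewrite inE => /andP[we wf].
have cR : #|e :\ v| = 2 * k by have := cardsD1 v e; rewrite ve ce; lia.
have wR : w \notin e :\ v by rewrite inE negb_and we orbT.
have RA : e :\ v \subset A by rewrite (subset_trans (subD1set _ _)).
have vA := subsetP eA v ve; have wA := subsetP fA w wf.
rewrite -[in LHS](setD1K ve) (exchange (w := w)) ?setD11 //.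
apply: IH => //.
- suff -> : (w |: e :\ v) :\: f = (e :\: f) :\ v.
    by have := cardsD1 v (e :\: f); rewrite inE vf ve En add1n => -[].
  apply/setP => x; rewrite !inE; have [->|_] := eqVneq x w.
    by rewrite wf /= andbF.
  by rewrite /= andbCA.
- by rewrite subUset sub1set wA.
- by rewrite cardsU1 wR cR addnC.
Qed.

(** By constancy, an edge [e] would make all three spokes of a configuration in [A] edges, and three
    is odd. *)
Lemma even_configs_empty (e : {set T}) :
  e \subset A -> #|e| = 2 * k + 1 -> ~~ h e.
Proof.
move=> eA ce; apply/negP => he.
have /card_gt0P[v ve] : 0 < #|e| by lia.
have cR : #|e :\ v| = 2 * k by have := cardsD1 v e; rewrite ve ce; lia.
have RA : e :\ v \subset A by rewrite (subset_trans (subD1set _ _)).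
have [S1 [S2 [[S1A S2A] c1 c2 d12 RE]]] := split_block RA cR.
have [|S3 /subsetDP[S3A d3] c3] := @subset_of_card _ (A :\: e) k.
  by rewrite cardsDS //; lia.
have eE : e = v |: (S1 :|: S2) by rewrite -RE setD1K.
have [v1 v2] : v \notin S1 /\ v \notin S2.
  by apply/norP; have := setD11 v e; rewrite RE inE => /= ->.
rewrite eE in d3.
have dj (S : {set T}) : S \subset S1 :|: S2 -> [disjoint S & S3].
  move=> sub; rewrite disjoint_sym; apply: disjointWr d3.
  by rewrite (subset_trans sub) // subsetUr.
have v3 : v \notin S3 by rewrite (disjointFl d3) // !inE eqxx.
have vA := subsetP eA v ve.
have d13 : [disjoint S1 & S3] by rewrite dj ?subsetUl.
have d23 : [disjoint S2 & S3] by rewrite dj ?subsetUr.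
have hsp (P Q : {set T}) : P \subset A -> Q \subset A -> v \notin P ->
    v \notin Q -> #|P| = k -> #|Q| = k -> [disjoint P & Q] -> h (spoke v P Q).
  move=> PA QA vP vQ cP cQ dPQ; rewrite -(@const e) //.
    by rewrite !subUset sub1set vA PA.
  rewrite cardsU1 inE negb_or vP vQ cardsU (disjoint_setI0 dPQ) cards0 cP cQ.
  by rewrite subn0 addnn mul2n addn1.
suff cfg : config k v S1 S2 S3.
  by have := even vA S1A S2A S3A cfg; rewrite !hsp.
by rewrite /config v1 v2 v3 c1 c2 c3 d12 d13 d23 !eqxx.
Qed.

End EvenConfigs.

Definition lone (T : finType) (h : {set T} -> bool) (v : T)
    (S1 S2 S3 : {set T}) : bool :=
  [&& h (spoke v S1 S2), ~~ h (spoke v S2 S3) & ~~ h (spoke v S1 S3)].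

(** When three edges are excluded, an odd configuration has exactly one edge, and a rotation of the
    blocks makes it the first spoke. Without such a configuration every one in [A] is even, and
    [even_configs_empty] contradicts [h e]. *)
Lemma exists_lone (T : finType) (k : nat) (A e : {set T})
    (h : {set T} -> bool) :
  0 < k -> 3 * k + 2 <= #|A| ->
  (forall v (S1 S2 S3 : {set T}), config k v S1 S2 S3 ->
    ~~ [&& h (spoke v S1 S2), h (spoke v S2 S3) & h (spoke v S1 S3)]) ->
  e \subset A -> #|e| = 2 * k + 1 -> h e ->
  exists v (S1 S2 S3 : {set T}),
    [&& v \in A, S1 \subset A, S2 \subset A & S3 \subset A]
    /\ config k v S1 S2 S3 && lone h v S1 S2 S3.
Proof.
move=> k0 cA free eA ce he.
pose good (c : T * {set T} * {set T} * {set T}) := let: (v, S1, S2, S3) := c in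
  [&& v \in A, S1 \subset A, S2 \subset A & S3 \subset A]
    && (config k v S1 S2 S3 && lone h v S1 S2 S3).
have [|] := boolP [exists c, good c].
  by move=> /existsP[[[[v S1] S2] S3] /andP[]]; exists v, S1, S2, S3.
rewrite negb_exists => /forallP nogood.
suff /negP[] : ~~ h e by [].
apply: (even_configs_empty k0 cA) => // v S1 S2 S3 vA S1A S2A S3A cfg.
have no (P Q R : {set T}) : P \subset A -> Q \subset A -> R \subset A ->
    config k v P Q R -> ~~ lone h v P Q R.
  move=> PA QA RA c; have := nogood (v, P, Q, R).
  by rewrite /good vA PA QA RA c.
have := free _ _ _ _ cfg; have := @no _ _ _ S1A S2A S3A cfg.
have := @no _ _ _ S2A S3A S1A (config_rot cfg).
have := @no _ _ _ S3A S1A S2A (config_rot (config_rot cfg)).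
rewrite /lone (spokeC v S3 S1) (spokeC v S2 S1) (spokeC v S3 S2).
by do 3 case: (h _).
Qed.

(** * A Mantel-type count in triangle-free graphs *)

(** For an edge ij and any l, triangle-freeness leaves exactly three cases: il is an edge, jl is an
    edge, or ij is the only edge. Summing over i, j, l expresses the lone triples through the
    squared degrees, which are then bounded below. *)
Lemma lone_edges_le (I : finType) (g : rel I) :
  symmetric g -> (forall i j l, ~~ [&& g i j, g j l & g i l]) ->
  2 * (\sum_i \sum_j \sum_l [&& g i j, ~~ g j l & ~~ g i l])
    + 2 * #|I| * (\sum_i \sum_j g i j) <= #|I| ^ 3.
Proof.
move=> gC gF.
set W := (X in 2 * X + _); set M := (X in _ + _ * X).
pose d i := \sum_j g i j.
have WD : W + 2 * (\sum_i d i ^ 2) = #|I| * M.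
  have D1 : \sum_i d i ^ 2 = \sum_i \sum_j \sum_l g i j * g i l.
    apply: eq_bigr => i _; rewrite expnS expn1 big_distrl.
    by apply: eq_bigr => j _; rewrite big_distrr.
  have D2 : \sum_i d i ^ 2 = \sum_i \sum_j \sum_l g i j * g j l.
    rewrite exchange_big; apply: eq_bigr => j _; rewrite expnS expn1 big_distrl.
    by apply: eq_bigr => i _; rewrite big_distrr gC.
  rewrite mul2n -addnn {1}D1 D2 addnA -!big_split big_distrr.
  apply: eq_bigr => i _; rewrite -!big_split big_distrr.
  apply: eq_bigr => j _; rewrite -!big_split /= -sum_nat_const.
  apply: eq_bigr => l _ /=; have := gF i j l.
  by do 3 case: (g _ _).
(* Summand by summand this is 2(2d)n <= (2d)^2 + n^2 with n = [#|I|], which is tight at d = n/2. *)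
have M4 : 4 * #|I| * M <= 4 * (\sum_i d i ^ 2) + #|I| ^ 3.
  rewrite (expnS _ 2) -sum_nat_const !big_distrr -big_split /=.
  apply: leq_sum => i _ /=; rewrite -/(d i).
  have [+ _] := nat_Cauchy (2 * d i) #|I|; rewrite expnMn -[2 ^ 2]/4.
  by rewrite !mulnA -[2 * 2]/4 mulnAC.
move: WD M4; rewrite -!mulnA; move: (#|I| * M) (\sum_i _) (#|I| ^ 3) => a b c.
lia.
Qed.

(** * Configurations with three edges are copies of the forbidden graph *)

Lemma contains_expanded_triangle (V : finType) (k : nat) (E : {set {set V}})
    (v : V) (S1 S2 S3 : {set V}) :
  config k v S1 S2 S3 ->
  spoke v S1 S2 \in E -> spoke v S2 S3 \in E -> spoke v S1 S3 \in E ->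
  contains (suspension (2 * k) (2 * k + 1) (expanded_triangle k)) E.
Proof.
move=> /and5P[v1 v2 v3 /eqP c1 /and5P[/eqP c2 /eqP c3 d12 d23 d13]] e12 e23 e13.
pose S (i : 'I_3) := nth S1 [:: S1; S2; S3] i.
have cS i : #|S i| = k by case: i => [[|[|[|]]]].
have vS i : v \notin S i by case: i => [[|[|[|]]]].
have dS i j x : x \in S i -> x \in S j -> i = j.
  move=> xi xj; apply/val_inj; move: xi xj.
  case: i j => [[|[|[|//]]]] hi [[|[|[|//]]]] hj //=; rewrite /S /= => xi xj;
    by rewrite ?(disjointFr d12 xi) ?(disjointFr d23 xi) ?(disjointFr d13 xi)
       ?(disjointFl d12 xi) ?(disjointFl d23 xi) ?(disjointFl d13 xi) in xj.
pose p (x : 'I_3 * 'I_k) := nth v (enum (S x.1)) x.2.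
have pS x : p x \in S x.1 by rewrite -mem_enum mem_nth // -cardE cS.
pose f (x : 'I_(2 * k + 1 - 2 * k) + 'I_3 * 'I_k) :=
  if x is inr y then p y else v.
have part i : p @: triangle_part k i = S i.
  apply/setP => x; apply/imsetP/idP => [[y + ->]|xS].
    by rewrite inE => /eqP <-.
  have xk : index x (enum (S i)) < k by rewrite -(cS i) cardE index_mem mem_enum.
  exists (i, Ordinal xk); rewrite ?inE //.
  by rewrite /p /= nth_index ?mem_enum.
have fE i j : [ffun x => f x] @: ([set inl c | c : 'I_(2 * k + 1 - 2 * k)] :|:
    [set inr x | x in (triangle_part k i :|: triangle_part k j)]) =
    spoke v (S i) (S j).
  have -> : [ffun x => f x] @: ([set inl c | c : 'I_(2 * k + 1 - 2 * k)] :|: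
    [set inr x | x in (triangle_part k i :|: triangle_part k j)]) =
    f @: ([set inl c | c : 'I_(2 * k + 1 - 2 * k)] :|:
    [set inr x | x in (triangle_part k i :|: triangle_part k j)]).
    by apply: eq_imset => x; rewrite ffunE.
  rewrite /spoke -!part -imsetU [LHS]imsetU; congr (_ :|: _);
    last by rewrite -imset_comp.
  apply/setP => x; rewrite inE; apply/imsetP/eqP.
    by move=> [y /imsetP[c _ ->] ->].
  move=> ->.
  have c0 : 0 < 2 * k + 1 - 2 * k by lia.
  by exists (inl (Ordinal c0)) => //; apply/imsetP; exists (Ordinal c0).
apply/existsP; exists [ffun x => f x]; apply/andP; split.
  (* The suspension adds 2k+1-2k = 1 vertex, so any two [inl] values coincide; the other cases use
     that [v] and the blocks are disjoint. *)
  apply/injectiveP => -[c|[i a]] [c'|[j b]]; rewrite !ffunE /=.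
  - move=> _; congr inl; apply/val_inj; have := ltn_ord c.
    by have := ltn_ord c'; move=> /=; lia.
  - by move=> vp; have := vS j; rewrite vp (pS (j, b)).
  - by move=> vp; have := vS i; rewrite -vp (pS (i, a)).
  move=> pp; have ij : i = j.
    by apply: (dS _ _ (p (i, a))); rewrite ?(pS (i, a)) // pp (pS (j, b)).
  subst j; congr (inr (_, _)); apply/val_inj/eqP.
  by move/eqP: pp; rewrite /p /= nth_uniq ?enum_uniq // -cardE cS.
apply/forall_inP => _ /imsetP[e + ->].
have Sk i (hi : i < 3) : S (inord i) = nth S1 [:: S1; S2; S3] i.
  by rewrite /S inordK.
rewrite !inE -orbA => /or3P[] /eqP->; rewrite fE !Sk //=.
by rewrite /spoke (setUC S3).
Qed.

(** * Averaging over all permutations of the vertex set *)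

Lemma card_mulg_perm (T : finType) (P : pred {perm T}) (s : {perm T}) :
  #|[set t | P (s * t)%g]| = #|[set t | P t]|.
Proof.
rewrite -(card_preimset [set t | P t] (mulgI s)).
by apply: eq_card => t; rewrite !inE.
Qed.

Lemma imset_mulg_perm (T : finType) (s t : {perm T}) (X : {set T}) :
  (s * t)%g @: X = t @: (s @: X).
Proof. by rewrite -imset_comp; apply: eq_imset => x; rewrite /= permM. Qed.

Lemma imset_perm_eq (T : finType) (s : {perm T}) (X Y : {set T}) :
  (forall x, (s x \in Y) = (x \in X)) -> s @: X = Y.
Proof.
move=> sE; apply/setP => y; rewrite -[y](permKV s) (mem_imset _ _ perm_inj).
by rewrite -sE.
Qed.

Lemma exists_perm_imset (T : finType) (X Y : {set T}) :
  #|X| = #|Y| -> exists s : {perm T}, s @: X = Y.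
Proof.
move=> XY; have [|s sE] := @perm_color _ _ (mem X) (mem Y).
  have cE (Z : {set T}) b :
      #|[set x | mem Z x == b]| = if b then #|Z| else #|~: Z|.
    by case: b; apply: eq_card => x; rewrite !inE ?eqb_id ?eqbF_neg.
  move=> b; rewrite !cE; case: b => //.
  by have := cardsC X; have := cardsC Y; lia.
by exists s; apply: imset_perm_eq.
Qed.

(** Colour the centre 0, the blocks 1, 2, 3 and the remaining vertices 4. The class sizes depend
    only on k and [#|T|], so [perm_color] applies. *)
Lemma config_exists_perm (T : finType) (k : nat) (v w : T)
    (S1 S2 S3 P1 P2 P3 : {set T}) :
  config k v S1 S2 S3 -> config k w P1 P2 P3 ->
  exists s : {perm T}, [/\ s v = w, s @: S1 = P1, s @: S2 = P2 & s @: S3 = P3].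
Proof.
pose col v (A B C : {set T}) (x : T) : nat :=
  if x == v then 0 else if x \in A then 1 else if x \in B then 2
  else if x \in C then 3 else 4.
have colE v0 (A B C : {set T}) : config k v0 A B C ->
    [/\ forall x, (x == v0) = (col v0 A B C x == 0),
        forall x, (x \in A) = (col v0 A B C x == 1),
        forall x, (x \in B) = (col v0 A B C x == 2) &
        forall x, (x \in C) = (col v0 A B C x == 3)].
  move=> /and5P[vA vB vC _ /and5P[_ _ dAB dBC dAC]].
  have nd (P Q : {set T}) x : [disjoint P & Q] -> ~~ ((x \in P) && (x \in Q)).
    by move=> d; apply/negP => /andP[/(disjointFr d)->].
  split=> x; rewrite /col; (have [xv|_] := eqVneq x v0; [subst x|]);
    rewrite ?(negPf vA) ?(negPf vB) ?(negPf vC) //;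
    move: (nd _ _ x dAB) (nd _ _ x dBC) (nd _ _ x dAC);
    by do 3 case: (x \in _).
have cardE v0 (A B C : {set T}) : config k v0 A B C -> forall c,
    #|[set x | col v0 A B C x == c]| =
    (* The default 0 of [nth] is the correct size for colours above 4, which never occur. *)
    nth 0 [:: 1; k; k; k; #|T| - (3 * k + 1)] c.
  move=> cfg; have [E0 E1 E2 E3] := colE _ _ _ _ cfg.
  move: cfg => /and5P[vA vB vC /eqP cA /and5P[/eqP cB /eqP cC dAB dBC dAC]].
  case=> [|[|[|[|[|c]]]]] /=.
  - by rewrite -(cards1 v0); apply: eq_card => x; rewrite !inE -E0.
  - by rewrite -cA; apply: eq_card => x; rewrite !inE -E1.
  - by rewrite -cB; apply: eq_card => x; rewrite !inE -E2.
  - by rewrite -cC; apply: eq_card => x; rewrite !inE -E3.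
  - have -> : [set x | col v0 A B C x == 4] = ~: (v0 |: (A :|: (B :|: C))).
      apply/setP => x; rewrite !inE /col.
      by do 4 case: ifP => //.
    have dABC : A :&: (B :|: C) = set0.
      by rewrite setIUr !disjoint_setI0 // setU0.
    have := cardsC (v0 |: (A :|: (B :|: C))).
    rewrite cardsU1 !inE !negb_or vA vB vC !cardsU dABC.
    by rewrite (disjoint_setI0 dBC) cards0 cA cB cC /=; lia.
  rewrite nth_nil; apply/eqP; rewrite cards_eq0 -subset0.
  apply/subsetP => x; rewrite !inE /col.
  by do 4 case: ifP => // _.
move=> cS cP.
have [|s sE] := @perm_color _ _ (col v S1 S2 S3) (col w P1 P2 P3).
  by move=> c; rewrite !cardE.
have [V0 V1 V2 V3] := colE _ _ _ _ cS; have [W0 W1 W2 W3] := colE _ _ _ _ cP.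
exists s; split; first by apply/eqP; rewrite W0 sE -V0.
- by apply: imset_perm_eq => x; rewrite V1 W1 sE.
- by apply: imset_perm_eq => x; rewrite V2 W2 sE.
- by apply: imset_perm_eq => x; rewrite V3 W3 sE.
Qed.

Lemma imset_spoke (T : finType) (s : {perm T}) (v : T) (S1 S2 : {set T}) :
  s @: spoke v S1 S2 = spoke (s v) (s @: S1) (s @: S2).
Proof. by rewrite /spoke !imsetU imset_set1. Qed.

Lemma card_spoke (T : finType) (k : nat) (v : T) (S1 S2 S3 : {set T}) :
  config k v S1 S2 S3 -> #|spoke v S1 S2| = 2 * k + 1.
Proof.
move=> /and5P[v1 v2 _ /eqP c1 /and5P[/eqP c2 _ d12 _ _]].
rewrite cardsU1 inE negb_or v1 v2 cardsU (disjoint_setI0 d12) cards0 c1 c2.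
by rewrite subn0 addnn mul2n addn1.
Qed.

Lemma config_imset (T : finType) (k : nat) (s : {perm T}) (v : T)
    (S1 S2 S3 : {set T}) :
  config k v S1 S2 S3 -> config k (s v) (s @: S1) (s @: S2) (s @: S3).
Proof.
rewrite /config !(mem_imset _ _ perm_inj) !(card_imset _ perm_inj).
by rewrite -!setI_eq0 -!imsetI ?imset_eq0 //; move=> ? ? _ _; apply: perm_inj.
Qed.

Section Averaging.

Variables (V : finType) (E : {set {set V}}).

Let h (s : {perm V}) (X : {set V}) : bool := s @: X \in E.

(** Multiplication by a permutation taking [X] to [Y] is a bijection of the group. Hence the chance
    that a random image is an edge depends only on the size of the set. *)
Lemma card_perm_edge (X Y : {set V}) :
  #|X| = #|Y| -> #|[set s | h s X]| = #|[set s | h s Y]|.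
Proof.
move=> /exists_perm_imset[t tXY].
rewrite -(card_mulg_perm [pred s | h s X] t); apply: eq_card => s; rewrite !inE.
by rewrite /h imset_mulg_perm tXY.
Qed.

Lemma card_perm_lone k v w (S1 S2 S3 P1 P2 P3 : {set V}) :
  config k v S1 S2 S3 -> config k w P1 P2 P3 ->
  #|[set s | lone (h s) v S1 S2 S3]| = #|[set s | lone (h s) w P1 P2 P3]|.
Proof.
move=> cS cP; have [t [tv t1 t2 t3]] := config_exists_perm cP cS.
rewrite -(card_mulg_perm [pred s | lone (h s) w P1 P2 P3] t); apply: eq_card => s.
by rewrite !inE /lone /h !imset_mulg_perm !(imset_spoke t) tv t1 t2 t3.
Qed.

(** Double counting of the pairs (Y, s) where Y has r elements and s maps Y to an edge: each s
    admits exactly [#|E|] sets Y. So the chance of hitting an edge is the edge density. *)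
Lemma card_perm_edgeE r (X : {set V}) : Defs.rgraph r E -> #|X| = r ->
  'C(#|V|, r) * #|[set s | h s X]| = #|{perm V}| * #|E|.
Proof.
move=> /forall_inP Er cX.
have -> : 'C(#|V|, r) * #|[set s | h s X]|
    = \sum_(Y : {set V} | #|Y| == r) \sum_(s : {perm V}) h s Y.
  rewrite -card_draws -sum_nat_const; apply: eq_big => Y; rewrite inE //.
  move=> /eqP cY; rewrite (@card_perm_edge X Y) ?cX ?cY //.
  rewrite -sum1_card big_mkcond /=; apply: eq_bigr => s _.
  by rewrite inE; case: (h s Y).
rewrite exchange_big -sum_nat_const; apply: eq_bigr => s _.
rewrite -(card_preimset E (imset_inj (@perm_inj _ s))) -sum1_card big_mkcond /=.
rewrite [RHS]big_mkcond; apply: eq_bigr => Y _; rewrite inE /h.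
case YE: (s @: Y \in E); last by case: ifP.
by rewrite -(card_imset _ (@perm_inj _ s)) (Er _ YE).
Qed.

End Averaging.

(** * Density below 1/2 on a large enough vertex set *)

(** Here [P] counts all permutations, [N] those sending a fixed set to an edge, [q] those making a
    fixed configuration lone. After [P <= 2 * N] and division by 2t the claim is tN < (t-1)(t-2)q.
    With [N <= L * q] it reduces to (L+4)L < (L+3)(L+2), which explains the choice of t. *)
Lemma no_lone_counts (L N P q t : nat) :
  0 < P -> P <= 2 * N -> N <= L * q -> t = L + 4 ->
  t ^ 3 * P < 2 * (t * (t - 1) * (t - 2) * q) + 2 * t * (t * (t - 1) * N).
Proof.
move=> P0 PN NL tE.
have q0 : 0 < q by case: q NL => // NL; lia.
apply: leq_ltn_trans (leq_mul (leqnn _) PN) _.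
have -> : t ^ 3 * (2 * N) = 2 * t * (t * t * N) by rewrite !expnS expn0; lia.
have -> : 2 * (t * (t - 1) * (t - 2) * q) + 2 * t * (t * (t - 1) * N) =
    2 * t * ((t - 1) * (t - 2) * q + t * (t - 1) * N) by lia.
rewrite ltn_pmul2l; last by lia.
have [-> ->] : t - 1 = L + 3 /\ t - 2 = L + 2 by lia.
subst t; suff : (L + 4) * N < (L + 3) * (L + 2) * q by nia.
apply: leq_ltn_trans (leq_mul (leqnn _) NL) _; rewrite mulnA ltn_pmul2r //.
by nia.
Qed.

Section Counting.

Variables (V : finType) (E : {set {set V}}) (k : nat).
Hypothesis k_gt0 : 0 < k.
Hypothesis Er : Defs.rgraph (2 * k + 1) E.
Hypothesis Efree :
  ~~ contains (suspension (2 * k) (2 * k + 1) (expanded_triangle k)) E.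

Let h (s : {perm V}) (X : {set V}) : bool := s @: X \in E.

Let free (s : {perm V}) v (S1 S2 S3 : {set V}) : config k v S1 S2 S3 ->
  ~~ [&& h s (spoke v S1 S2), h s (spoke v S2 S3) & h s (spoke v S1 S3)].
Proof.
move=> cfg; apply: contra Efree => /and3P[]; rewrite /h !imset_spoke.
exact/contains_expanded_triangle/config_imset.
Qed.

(** Union bound: whenever the image of [e] is an edge, some configuration in [A] is lone. There are
    at most [#|A| * (2 ^ #|A|) ^ 3] configurations in [A], and each is lone for the same number of
    permutations. *)
Lemma edge_le_lone (A e : {set V}) v (S1 S2 S3 : {set V}) :
  3 * k + 2 <= #|A| -> e \subset A -> #|e| = 2 * k + 1 ->
  config k v S1 S2 S3 ->
  #|[set s | h s e]| <=
    #|A| * (2 ^ #|A|) ^ 3 * #|[set s | lone (h s) v S1 S2 S3]|.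
Proof.
move=> cA eA ce cS; set q := #|[set s | lone _ _ _ _ _]|.
pose P := powerset A.
pose L : {set V * {set V} * {set V} * {set V}} :=
  [set c in setX (setX (setX A P) P) P |
    config k c.1.1.1 c.1.1.2 c.1.2 c.2].
have cL : #|L| <= #|A| * (2 ^ #|A|) ^ 3.
  apply: (@leq_trans #|setX (setX (setX A P) P) P|).
    by apply/subset_leq_card/subsetP => c; rewrite inE => /andP[].
  by rewrite !cardsX !card_powerset !expnS expn0 muln1 !mulnA.
apply: leq_trans (leq_mul cL (leqnn q)).
rewrite -sum_nat_const.
have -> : \sum_(c in L) q =
    \sum_(c in L) \sum_(s : {perm V}) lone (h s) c.1.1.1 c.1.1.2 c.1.2 c.2.
  apply: eq_bigr => c; rewrite inE => /andP[_ cfg].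
  rewrite /q (card_perm_lone E cS cfg) -sum1_card big_mkcond /=.
  by apply: eq_bigr => s _; rewrite inE; case: lone.
rewrite exchange_big -sum1_card big_mkcond /=; apply: leq_sum => s _.
rewrite inE; case: ifP => // he.
have [w [P1 [P2 [P3 [/and4P[wA P1A P2A P3A] /andP[cP lP]]]]]] :=
  exists_lone k_gt0 cA (@free s) eA ce he.
rewrite (bigD1 (w, P1, P2, P3)) /= ?lP //.
by rewrite inE /= cP !in_setX /= wA !powersetE P1A P2A P3A.
Qed.

(** Each permutation s defines a triangle-free graph on the t indices; [lone_edges_le] is applied to
    it and summed over s. *)
Lemma average_lone_edges_le (t : nat) (v : V) (S : 'I_t -> {set V})
    (e S1 S2 S3 : {set V}) :
  (forall i, v \notin S i) -> (forall i, #|S i| = k) ->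
  (forall i j, i != j -> [disjoint S i & S j]) ->
  #|e| = 2 * k + 1 -> config k v S1 S2 S3 ->
  2 * (t * (t - 1) * (t - 2) * #|[set s | lone (h s) v S1 S2 S3]|)
    + 2 * t * (t * (t - 1) * #|[set s | h s e]|) <= t ^ 3 * #|{perm V}|.
Proof.
move=> vS cS dS ce cfg.
set q := #|[set s | lone _ _ _ _ _]|; set N := #|[set s | h s e]|.
have cfgS i j l : i != j -> j != l -> i != l -> config k v (S i) (S j) (S l).
  by move=> ij jl il; rewrite /config !vS !cS !dS // !eqxx.
pose g s (i j : 'I_t) := (i != j) && h s (spoke v (S i) (S j)).
have gC s : symmetric (g s).
  by move=> i j; rewrite /g eq_sym /spoke (setUC (S i)).
have gF s i j l : ~~ [&& g s i j, g s j l & g s i l].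
  apply/negP => /and3P[/andP[ij hij] /andP[jl hjl] /andP[il hil]].
  by have := free s (cfgS _ _ _ ij jl il); rewrite hij hjl hil.
have Mle : \sum_s \sum_i \sum_j g s i j = t * (t - 1) * N.
  rewrite exchange_big -mulnA -[X in _ = X * _](card_ord t) -sum_nat_const.
  apply: eq_bigr => i _; rewrite exchange_big /=.
  have -> : t - 1 = #|[set~ i]| by rewrite cardsC1 card_ord subn1.
  rewrite -sum_nat_const [RHS]big_mkcond; apply: eq_bigr => j _.
  rewrite !inE /g eq_sym; have [_|ij] := eqVneq j i; first by rewrite big1.
  rewrite /N (@card_perm_edge _ _ e (spoke v (S i) (S j))).
    rewrite -sum1_card [RHS]big_mkcond; apply: eq_bigr => s _.
    by rewrite inE /= -/(h s _); case: h.
  rewrite ce cardsU1 inE negb_or !vS cardsU disjoint_setI0 ?dS 1?eq_sym //.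
  by rewrite cards0 !cS subn0 addnn mul2n addn1.
(* Only triples of distinct indices are kept; each of them is lone for q permutations. *)
have Wge : t * (t - 1) * (t - 2) * q <=
    \sum_s \sum_i \sum_j \sum_l [&& g s i j, ~~ g s j l & ~~ g s i l].
  rewrite exchange_big -!mulnA -[X in X * _ <= _](card_ord t) -sum_nat_const.
  apply: leq_sum => i _; rewrite exchange_big /=.
  have -> : t - 1 = #|[set~ i]| by rewrite cardsC1 card_ord subn1.
  rewrite -sum_nat_const big_mkcond; apply: leq_sum => j _.
  rewrite !inE; case: ifP => // ji; rewrite exchange_big /=.
  have -> : t - 2 = #|~: [set i; j]|.
    have := cardsC [set i; j]; rewrite cards2 eq_sym ji card_ord.
    by move: (#|~: _|) => c /=; lia.
  rewrite -sum_nat_const big_mkcond; apply: leq_sum => l _.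
  rewrite !inE negb_or; case: ifP => // /andP[li lj].
  have cijl : config k v (S i) (S j) (S l) by apply: cfgS; rewrite eq_sym.
  rewrite /q (card_perm_lone E cfg cijl) -sum1_card big_mkcond.
  apply: leq_sum => s _; rewrite inE /lone /g.
  rewrite (eq_sym i j) ji (eq_sym j l) lj (eq_sym i l) li /=.
  by case: ifP => // ->.
rewrite -Mle.
apply: leq_trans (leq_add (leq_mul (leqnn 2) Wge) (leqnn _)) _.
rewrite !big_distrr -big_split /= [leqRHS]mulnC -sum_nat_const.
by apply: leq_sum => s _; have := lone_edges_le (gC s) (gF s); rewrite card_ord.
Qed.

Lemma card_lt_half (t : nat) (v : V) (S : 'I_t -> {set V}) :
  (forall i, v \notin S i) -> (forall i, #|S i| = k) ->
  (forall i j, i != j -> [disjoint S i & S j]) ->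
  t = (4 * k + 1) * (2 ^ (4 * k + 1)) ^ 3 + 4 ->
  2 * #|E| < 'C(#|V|, 2 * k + 1).
Proof.
set L := _ * _ => vS cS dS tE.
have t4 : 3 < t by lia.
pose i0 : 'I_t := Ordinal (ltn_trans (isT : 0 < 3) t4).
pose i1 : 'I_t := Ordinal (ltn_trans (isT : 1 < 3) t4).
pose i2 : 'I_t := Ordinal (ltn_trans (isT : 2 < 3) t4).
pose i3 : 'I_t := Ordinal t4.
have cfg : config k v (S i0) (S i1) (S i2).
  by rewrite /config !vS !cS !dS // !eqxx.
pose e := spoke v (S i0) (S i1).
have ce : #|e| = 2 * k + 1 := card_spoke cfg.
(* Three blocks and the centre have 3k+1 points, one too few for [edge_le_lone]; a fourth block
   gives 4k+1 >= 3k+2. *)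
pose A := v |: ((S i0 :|: S i1) :|: (S i2 :|: S i3)).
have cA : #|A| = 4 * k + 1.
  have dj : (S i0 :|: S i1) :&: (S i2 :|: S i3) = set0.
    by rewrite setIUr !setIUl !disjoint_setI0 ?dS // !setU0.
  rewrite cardsU1 !inE !negb_or !vS cardsU dj !cardsU !disjoint_setI0 ?dS //.
  by rewrite cards0 !cS /=; lia.
have eA : e \subset A by rewrite setUS // subsetUl.
have := edge_le_lone (A := A) (e := e) _ eA ce cfg.
have := average_lone_edges_le vS cS dS ce cfg.
have := card_perm_edgeE Er ce.
rewrite cA -/L; set N := #|[set s | _ @: e \in E]|.
set q := #|[set s | lone _ _ _ _ _]|.
rewrite -/N -/q => NE avg /(_ _)NL.
have {}NL : N <= L * q by apply: NL; lia.
have P0 : 0 < #|{perm V}| by apply/card_gt0P; exists 1%g.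
have C0 : 0 < 'C(#|V|, 2 * k + 1) by rewrite bin_gt0 -ce max_card.
rewrite ltnNge; apply/negP => half.
(* The identity [NE] turns edge density at least 1/2 into the same bound on the share of
   permutations. *)
have PN : #|{perm V}| <= 2 * N.
  rewrite -(leq_pmul2l C0) mulnCA NE mulnCA mulnC leq_mul2l half orbT //.
by have := no_lone_counts P0 PN NL tE; rewrite ltnNge avg.
Qed.

End Counting.

(** * From one vertex number to the limit *)

Lemma turan_ratioS (R : realType) (r n : nat) (U : finType)
    (F : {set {set U}}) :
  r <= n -> (turan_ratio R r F n.+1 <= turan_ratio R r F n)%R.
Proof.
move=> rn; have rn1 := leqW rn.
rewrite /turan_ratio ler_pdivrMr ?ltr0n ?bin_gt0 // mulrAC.
rewrite ler_pdivlMr ?ltr0n ?bin_gt0 // -!natrM ler_nat.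
rewrite -(@leq_pmul2l (n.+1 - r)) ?subn_gt0 ?ltnS // mulnA [leqRHS]mulnCA.
by rewrite -mul_bin_down mulnCA mulnA leq_mul2r ex_succ orbT.
Qed.

Lemma turan_density_le_ratio (R : realType) (r n : nat) (U : finType)
    (F : {set {set U}}) :
  r <= n -> (turan_density R r F <= turan_ratio R r F n)%R.
Proof.
move=> rn; apply: limr_le; first exact: is_cvg_turan_ratio.
exists n => // m /= /subnKC <-; elim: (m - n) => [|d IH]; first by rewrite addn0.
by rewrite addnS (le_trans _ IH) // turan_ratioS // (leq_trans rn) // leq_addr.
Qed.

Theorem theorem3p1 (R : realType) (k : nat) (hk : (1 <= k)%N) :
  (turan_density R (2 * k + 1)
     (suspension (2 * k) (2 * k + 1) (expanded_triangle k)) < 1 / 2)%R.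
Proof.
pose t := (4 * k + 1) * (2 ^ (4 * k + 1)) ^ 3 + 4.
(* The ground set has exactly the centre, as [None], and t disjoint blocks of k points; [enum_rank]
   moves it to ordinals. *)
pose X := option ('I_t * 'I_k).
pose v : 'I_#|{: X}| := enum_rank (None : X).
pose S (i : 'I_t) : {set 'I_#|{: X}|} :=
  [set enum_rank (Some (i, j) : X) | j : 'I_k].
have vS i : v \notin S i.
  by apply/imsetP => -[j _ /enum_rank_inj].
have cS i : #|S i| = k.
  by rewrite card_imset ?card_ord // => a b /enum_rank_inj[].
have dS i j : i != j -> [disjoint S i & S j].
  move=> ij; rewrite -setI_eq0; apply/eqP/setP => x; rewrite !inE.
  apply/andP => -[/imsetP[a _ ->] /imsetP[b _ /enum_rank_inj[ij' _]]].
  by rewrite ij' eqxx in ij.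
have nk : 2 * k + 1 <= #|{: X}|.
  rewrite card_option card_prod !card_ord addn1 ltnS leq_mul2r.
  by rewrite (leq_trans _ (leq_addl _ _)) ?orbT.
apply: le_lt_trans (turan_density_le_ratio R _ nk) _.
rewrite /turan_ratio ltr_pdivrMr ?ltr0n ?bin_gt0 // mulrAC mul1r.
rewrite ltr_pdivlMr ?ltr0n // -natrM ltr_nat mulnC.
(* The strict bound passes to the maximum because it also holds for the initial value 0, the
   binomial coefficient being positive by [nk]. *)
rewrite /ex; elim/big_ind: _ => [|a b a_lt b_lt|E /andP[Er Efree]].
- by rewrite muln0 bin_gt0.
- by rewrite /maxn; case: ifP.
by have := card_lt_half hk Er Efree vS cS dS erefl; rewrite card_ord.
Qed.
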